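(* For every complex number $s$ with $\operatorname{Re}(s)>1$, \[ \zeta(s)=e\sum_{n=0}^{\infty}\sum_{i=0}^{n}(-1)^{n-i}\frac{1}{(n-i)!\,(1+i)^{s}}. \]
   Context: Here $\zeta$ is the Riemann zeta function, $\zeta(s)=\sum_{n=1}^{\infty}\frac{1}{n^{s}}$ for $\operatorname{Re}(s)>1$, and $e$ is the base of the natural logarithm. The right-hand side is the infinite series over $n$ whose $n$-th term is the finite inner sum over $0\le i\le n$. *)

(* Defs.v *)
From Stdlib Require Import Reals.
From Coquelicot Require Export Coquelicot.

Open Scope C_scope.

Definition Cexp (z : C) : C :=
  (exp (Re z) * cos (Im z), exp (Re z) * sin (Im z))%R.

(* Complex power of a positive real base, with the real logarithm.  It is
   meaningful only for [0 < x], since [ln x = 0] for [x <= 0]. *)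
Definition Rcpower (x : R) (s : C) : C := Cexp (s * RtoC (ln x)).

(* Sum of a complex series: Coquelicot's [Series] is restricted to real terms.
   Unspecified when the series diverges, see [CSeries_unique] and
   [CSeries_correct]. *)
Definition CSeries (a : nat -> C) : C :=
  (Series (fun n => Re (a n)), Series (fun n => Im (a n))).

(* The Dirichlet series of zeta, hence meaningful only for [1 < Re s]: no
   analytic continuation is involved.  The index is shifted to start at 0. *)
Definition zeta (s : C) : C :=
  CSeries (fun n => 1 / Rcpower (INR (S n)) s).

Lemma sum_n_Re_Im (a : nat -> C) (n : nat) :
  sum_n a n = (sum_n (fun k => Re (a k)) n, sum_n (fun k => Im (a k)) n).
Proof.
induction n as [|n IH].
- rewrite !sum_O. now destruct (a 0%nat).
- rewrite !sum_Sn, IH. reflexivity.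
Qed.

Lemma is_series_Re_Im (a : nat -> C) (l : C) :
  is_series a l <->
  is_series (fun n => Re (a n)) (Re l) /\ is_series (fun n => Im (a n)) (Im l).
Proof.
assert (E : forall n, sum_n a n =
  (sum_n (fun k => Re (a k)) n, sum_n (fun k => Im (a k)) n))
  by apply sum_n_Re_Im.
split.
- intros H; split; intros P [eps He]; unfold filtermap.
  + destruct (H (fun z : C => P (Re z))) as [N HN].
    { exists eps. intros z Hz. apply He, Hz. }
    exists N. intros n Hn. generalize (HN n Hn). rewrite E. easy.
  + destruct (H (fun z : C => P (Im z))) as [N HN].
    { exists eps. intros z Hz. apply He, Hz. }
    exists N. intros n Hn. generalize (HN n Hn). rewrite E. easy.
- intros [H1 H2] P [eps He]; unfold filtermap.
  destruct (H1 (ball (Re l) eps)) as [N1 HN1]. { now exists eps. }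
  destruct (H2 (ball (Im l) eps)) as [N2 HN2]. { now exists eps. }
  exists (Nat.max N1 N2). intros n Hn. apply He. rewrite E. split.
  + apply HN1. apply Nat.le_trans with (2 := Hn), Nat.le_max_l.
  + apply HN2. apply Nat.le_trans with (2 := Hn), Nat.le_max_r.
Qed.

Lemma CSeries_unique (a : nat -> C) (l : C) : is_series a l -> CSeries a = l.
Proof.
intros [H1 H2]%is_series_Re_Im. unfold CSeries.
rewrite (is_series_unique _ _ H1), (is_series_unique _ _ H2). now destruct l.
Qed.

Lemma CSeries_correct (a : nat -> C) : ex_series a -> is_series a (CSeries a).
Proof. intros [l H]. now rewrite (CSeries_unique a l H). Qed.

(* Main.v *)
Require Import Defs.
From Stdlib Require Import Reals Factorial Lra.
From Coquelicot Require Import Coquelicot.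

(** The right-hand series is the Cauchy product of the Dirichlet series of
    [zeta s] with the exponential series at [-1]; both converge absolutely, so
    its sum is [zeta s * exp (-1)]. *)

(** Since [|x^s| = x^(Re s)] for [x > 0] ([Cmod_Rcpower]), absolute convergence of the Dirichlet
    series reduces to the real series of [1/n^p] with [p > 1], which [ex_series_inv_Rpower] bounds
    by a telescoping sum instead of an integral. [is_series_Cauchy_product_C] then sums the double
    series to [zeta s / e], and multiplying by [e] gives the identity. *)

(** Because [b] is real, real and imaginary parts do not mix: each is a real Cauchy product, and
    [|Re|] and [|Im|] are dominated by [Cmod]. *)
Lemma is_series_Cauchy_product_C (a : nat -> C) (b : nat -> R) (la : C) (lb : R) :
  is_series a la -> is_series b lb ->
  ex_series (fun n => Cmod (a n)) -> ex_series (fun n => Rabs (b n)) ->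
  is_series (fun n => sum_n (fun i => (a i * RtoC (b (n - i)%nat))%C) n)
    (la * RtoC lb)%C.
Proof.
intros [Hre Him]%is_series_Re_Im Hb Habs Hbabs.
assert (Hre_abs : ex_series (fun n => Rabs (Re (a n)))).
{ apply (ex_series_le (V := R_CompleteNormedModule)) with (2 := Habs). intros n.
  change (Rabs (Rabs (Re (a n))) <= Cmod (a n))%R.
  rewrite Rabs_Rabsolu. apply Rle_trans with (2 := Rmax_Cmod _). apply Rmax_l. }
assert (Him_abs : ex_series (fun n => Rabs (Im (a n)))).
{ apply (ex_series_le (V := R_CompleteNormedModule)) with (2 := Habs). intros n.
  change (Rabs (Rabs (Im (a n))) <= Cmod (a n))%R.
  rewrite Rabs_Rabsolu. apply Rle_trans with (2 := Rmax_Cmod _). apply Rmax_r. }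
apply is_series_Re_Im. split.
- replace (Re (la * RtoC lb)) with (Re la * lb)%R
    by (unfold Re, Im; cbn; ring).
  eapply is_series_ext; [|exact (is_series_mult _ _ _ _ Hre Hb Hre_abs Hbabs)].
  intros n. rewrite sum_n_Re_Im, <- sum_n_Reals. simpl.
  apply sum_n_ext. intros i. cbn. unfold Re, Im. ring.
- replace (Im (la * RtoC lb)) with (Im la * lb)%R
    by (unfold Re, Im; cbn; ring).
  eapply is_series_ext; [|exact (is_series_mult _ _ _ _ Him Hb Him_abs Hbabs)].
  intros n. rewrite sum_n_Re_Im, <- sum_n_Reals. simpl.
  apply sum_n_ext. intros i. cbn. unfold Re, Im. ring.
Qed.

Lemma Cmod_Cexp (z : C) : Cmod (Cexp z) = exp (Re z).
Proof.
unfold Cmod, Cexp. cbn [fst snd].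
replace ((exp (Re z) * cos (Im z)) ^ 2 + (exp (Re z) * sin (Im z)) ^ 2)%R
  with (exp (Re z) ^ 2)%R.
- apply sqrt_pow2, Rlt_le, exp_pos.
- generalize (sin2_cos2 (Im z)). unfold Rsqr. intros E.
  transitivity (exp (Re z) ^ 2 *
    (sin (Im z) * sin (Im z) + cos (Im z) * cos (Im z)))%R.
  + rewrite E. ring.
  + ring.
Qed.

Lemma Cexp_neq_0 (z : C) : Cexp z <> 0%C.
Proof.
intros E. generalize (exp_pos (Re z)).
rewrite <- Cmod_Cexp, E, Cmod_0. apply Rlt_irrefl.
Qed.

Lemma Cmod_Rcpower (x : R) (s : C) : Cmod (Rcpower x s) = Rpower x (Re s).
Proof.
unfold Rcpower. rewrite Cmod_Cexp. unfold Rpower, Re. f_equal. simpl. ring.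
Qed.

(** This is [1 + x <= exp x] at [x = ln ((n+1)/(n+2))], where [exp x = 1 - 1/(n+2)]. *)
Lemma Rinv_le_ln_succ (n : nat) :
  (/ INR (S (S n)) <= ln (INR (S (S n))) - ln (INR (S n)))%R.
Proof.
assert (H1 : (0 < INR (S n))%R) by apply lt_0_INR, Nat.lt_0_succ.
assert (H2 : (0 < INR (S (S n)))%R) by apply lt_0_INR, Nat.lt_0_succ.
generalize (exp_ineq1_le (ln (INR (S n)) - ln (INR (S (S n)))))%R.
unfold Rminus at 2. rewrite exp_plus, exp_Ropp, !exp_ln by assumption.
rewrite (S_INR (S n)) in *.
replace (INR (S n) * / (INR (S n) + 1))%R with (1 - / (INR (S n) + 1))%R
  by (field; lra).
lra.
Qed.

(* The discrete form of [x ^ (- t - 1) <= - (x ^ (- t))' / t]. *)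
Lemma Rpower_succ_telescope (t : R) (n : nat) : (0 < t)%R ->
  (/ Rpower (INR (S (S n))) (1 + t) <=
   / t * (Rpower (INR (S n)) (- t) - Rpower (INR (S (S n))) (- t)))%R.
Proof.
intros Ht.
assert (H2 : (0 < INR (S (S n)))%R) by apply lt_0_INR, Nat.lt_0_succ.
assert (Hl := Rinv_le_ln_succ n).
rewrite <- Rpower_Ropp.
replace (- (1 + t))%R with (- t + - (1))%R by ring.
rewrite Rpower_plus, (Rpower_Ropp _ 1), Rpower_1 by assumption.
(* With [d = ln ((n+2)/(n+1))], factoring out [(n+2)^(-t)] leaves [t/(n+2) <= exp (t d) - 1], which
   follows from [exp (t d) - 1 >= t d] and [d >= 1/(n+2)]. *)
replace (Rpower (INR (S n)) (- t)) with (Rpower (INR (S (S n))) (- t) *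
  exp (t * (ln (INR (S (S n))) - ln (INR (S n)))))%R
  by (unfold Rpower; rewrite <- exp_plus; f_equal; ring).
assert (He := exp_ineq1_le (t * (ln (INR (S (S n))) - ln (INR (S n))))).
assert (Hp : (0 < Rpower (INR (S (S n))) (- t))%R) by apply exp_pos.
revert Hl He Hp.
generalize (ln (INR (S (S n))) - ln (INR (S n)))%R (/ INR (S (S n)))%R
  (Rpower (INR (S (S n))) (- t)).
intros d v p Hl He Hp.
apply Rmult_le_reg_l with t; [exact Ht|].
replace (t * (/ t * (p * exp (t * d) - p)))%R with (p * (exp (t * d) - 1))%R
  by (field; lra).
replace (t * (p * v))%R with (p * (t * v))%R by ring.
apply Rmult_le_compat_l; [lra|].
apply (Rmult_le_compat_l t) in Hl; lra.
Qed.

Lemma ex_series_inv_Rpower (p : R) : (1 < p)%R ->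
  ex_series (fun n => / Rpower (INR (S n)) p)%R.
Proof.
intros Hp.
set (t := (p - 1)%R). assert (Ht : (0 < t)%R) by (unfold t; lra).
replace p with (1 + t)%R by (unfold t; ring).
assert (Hpos : forall x y, (0 < Rpower x y)%R) by (intros; apply exp_pos).
assert (Hti := Rinv_0_lt_compat _ Ht).
(* The [1] is the first term; the other terms telescope. Keeping the decaying power makes the
   induction go through; dropping it later gives the uniform bound [1 + / t]. *)
assert (Hbound : forall n, (sum_n (fun k => / Rpower (INR (S k)) (1 + t)) n <=
  1 + / t * (1 - Rpower (INR (S n)) (- t)))%R).
{ induction n as [|n IH].
  - rewrite sum_O. unfold Rpower. simpl INR.
    rewrite ln_1, !Rmult_0_r, exp_0. lra.
  - rewrite sum_Sn. change plus with Rplus.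
    assert (H := Rpower_succ_telescope t n Ht). lra. }
assert (Hlim : ex_finite_lim_seq
  (sum_n (fun k => / Rpower (INR (S k)) (1 + t))%R)).
{ apply ex_finite_lim_seq_incr with (1 + / t)%R.
  - intros n. rewrite sum_Sn. change plus with Rplus.
    assert (H := Rinv_0_lt_compat _ (Hpos (INR (S (S n))) (1 + t)%R)). lra.
  - intros n. apply Rle_trans with (1 := Hbound n).
    assert (H := Rmult_lt_0_compat _ _ Hti (Hpos (INR (S n)) (- t)%R)). lra. }
destruct Hlim as [l Hl]. now exists l.
Qed.

Lemma is_series_exp (x : R) :
  is_series (fun n => x ^ n / INR (fact n))%R (exp x).
Proof.
eapply is_series_ext; [|exact (is_exp_Reals x)].
intros n. exact (f_equal (fun y => (y * _)%R) (pow_n_pow x n)).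
Qed.

Lemma ex_series_exp_Rabs (x : R) :
  ex_series (fun n => Rabs (x ^ n / INR (fact n)))%R.
Proof.
exists (exp (Rabs x)).
eapply is_series_ext; [|exact (is_series_exp (Rabs x))].
intros n. rewrite Rabs_div by apply INR_fact_neq_0.
rewrite <- RPow_abs, (Rabs_pos_eq (INR _)) by apply pos_INR. reflexivity.
Qed.

Lemma ex_series_Cmod_zeta (s : C) : (1 < Re s)%R ->
  ex_series (fun n => Cmod (1 / Rcpower (INR (S n)) s)%C).
Proof.
intros hs. eapply ex_series_ext; [|exact (ex_series_inv_Rpower _ hs)].
intros n. rewrite Cmod_div, Cmod_1, Cmod_Rcpower by apply Cexp_neq_0.
symmetry. apply Rmult_1_l.
Qed.

(** Convergence is part of the conclusion because [CSeries] is unspecified on divergent series. *)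
Theorem theorem3p1 (s : C) (hs : (1 < Re s)%R) :
  let inner : nat -> C := fun n : nat =>
    sum_n (fun i : nat =>
      ((- 1) ^ (n - i)
        * (1 / (RtoC (INR (fact (n - i))) * Rcpower (INR (1 + i)) s)))%C) n in
  ex_series inner /\ zeta s = (RtoC (exp 1) * CSeries inner)%C.
Proof.
intros inner.
assert (Hmod := ex_series_Cmod_zeta s hs).
assert (Hzeta : is_series (fun n => (1 / Rcpower (INR (S n)) s)%C) (zeta s)).
{ apply CSeries_correct.
  exact (ex_series_le (V := C_CompleteNormedModule) _ _
    (fun n => Rle_refl _) Hmod). }
assert (Hinner : is_series inner (zeta s * RtoC (exp (- 1)))%C).
{ eapply is_series_ext; [|exact (is_series_Cauchy_product_C _ _ _ _ Hzeta
    (is_series_exp (- 1)) Hmod (ex_series_exp_Rabs (- 1)))].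
  intros n. apply sum_n_ext. intros i.
  (* The equality is retyped over [C] itself, rather than the carrier of an algebraic structure, for
     [field]. *)
  refine (_ : @eq C _ _). rewrite RtoC_div by apply INR_fact_neq_0.
  rewrite RtoC_pow. change (1 + i)%nat with (S i). field. split.
  - apply Cexp_neq_0.
  - intros E%RtoC_inj. exact (INR_fact_neq_0 _ E). }
split; [eexists; exact Hinner|].
(* The literal [-1] becomes an opposite, so that [exp_Ropp] turns [exp (- 1)] into [/ exp 1], which
   cancels the factor [e]. *)
change (- 1)%R with (- (1))%R in Hinner.
rewrite (CSeries_unique _ _ Hinner), exp_Ropp, RtoC_inv
  by apply Rgt_not_eq, exp_pos.
field. intros E%RtoC_inj. generalize (exp_pos 1). lra.
Qed.
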